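(* Let $(M,g)$ be a Riemannian manifold with Riemann curvature tensor $R$, let $p\in M$, and let $W,X,Y,Z\in T_pM$ and $\sigma\in\mathbb{R}$. If $(W,X,Y,Z,\sigma)$ solves the singular value problem of the Riemann tensor, then each of the following 5-tuples also solves it: $$(X,W,Y,Z,-\sigma),\quad (W,X,Z,Y,-\sigma),\quad (X,W,Z,Y,\sigma),\quad (Y,Z,W,X,\sigma).$$
   Context: Let $(M,g)$ be a Riemannian manifold, $\langle\cdot,\cdot\rangle = g(\cdot,\cdot)$, and $\nabla$ its Levi-Civita connection. The curvature operator is $R(X,Y) = [\nabla_X,\nabla_Y]-\nabla_{[X,Y]}$, and the $(0,4)$ curvature tensor is $R(W,Z,X,Y) := \langle W, R(X,Y)Z\rangle$ for $W,X,Y,Z\in T_pM$. Definition (singular value problem, SVP): a 5-tuple $(W,X,Y,Z,\sigma)$ with $W,X,Y,Z\in T_pM$ and $\sigma\in\mathbb{R}$ solves the singular value problem of the Riemann tensor if $$R(Y,Z)X=\sigma W,\quad R(Z,Y)W=\sigma X,\quad R(W,X)Z=\sigma Y,\quad R(X,W)Y=\sigma Z,$$ and $$\langle W,W\rangle=\langle X,X\rangle=\langle Y,Y\rangle=\langle Z,Z\rangle=1.$$ In a 5-tuple the entries are always listed in the order (first vector in the role of $W$, second of $X$, third of $Y$, fourth of $Z$, scalar in the role of $\sigma$). *)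

(* Defs.v *)
From HB Require Import structures.
From mathcomp Require Import all_boot all_order all_algebra.
From mathcomp Require Import all_classical all_reals all_analysis.
From mathcomp Require Import ring.

Set Implicit Arguments.
Unset Strict Implicit.
Unset Printing Implicit Defensive.

Import Order.TTheory GRing.Theory Num.Theory.
Import numFieldNormedType.Exports.

Local Open Scope classical_set_scope.
Local Open Scope ring_scope.

Section EuclideanSmoothness.
Variables (R : realType) (n : nat).
Implicit Types (U : set 'rV[R]_n) (f g : 'rV[R]_n -> R).

Local Notation evec i := (delta_mx 0 i : 'rV[R]_n).

(* [f] has continuous iterated partial derivatives up to order [k] on [U];
   only meaningful for [U] open. *)
Fixpoint Ck (k : nat) U f : Prop :=
  (forall x, U x -> {for x, continuous f}) /\
  if k is k'.+1 then
    forall i : 'I_n, (forall x, U x -> derivable f x (evec i)) /\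
                     Ck k' U (fun x => 'D_(evec i) f x)
  else True.

Definition smooth_on U f := forall k, Ck k U f.

Lemma Ck_ext k U f g : open U -> (forall x, U x -> f x = g x) ->
  Ck k U f -> Ck k U g.
Proof.
move=> oU; elim: k f g => [|k IH] f g fg [cf df].
all: have nfg x : U x -> \forall y \near x, f y = g y
  by move=> Ux; apply: filterS fg _; exact: open_nbhs_nbhs.
all: have cg x : U x -> {for x, continuous g}
  by move=> Ux; rewrite /prop_for /continuous_at -(fg x Ux);
     exact: (cvg_trans (near_eq_cvg (nfg x Ux)) (cf x Ux)).
- by split.
- split=> // i; have [dfi Cdf] := df i; split.
    by move=> x Ux; apply: near_eq_derivable (dfi x Ux); exact: nfg.
  by apply: IH Cdf => x Ux; apply: near_eq_derive; exact: nfg.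
Qed.

Lemma CkS k U f : Ck k.+1 U f -> Ck k U f.
Proof.
elim: k f => [|k IH] f [cf df]; split=> // i.
by have [dfi Cdf] := df i; split=> //; exact: IH.
Qed.

Lemma Ck_cst k U (c : R) : Ck k U (fun=> c).
Proof.
elim: k c => [|k IH] c; first by split=> // x _; exact: cst_continuous.
split=> [x _|i]; first exact: cst_continuous.
split=> [x _|]; first exact: derivable_cst.
have -> : (fun x : 'rV[R]_n => 'D_(evec i) (fun=> c) x) = (fun=> 0 : R).
  by rewrite funeqE => x; exact: derive_cst.
exact: IH.
Qed.

Lemma CkD k U f g : open U -> Ck k U f -> Ck k U g -> Ck k U (f + g).
Proof.
move=> oU; elim: k f g => [|k IH] f g [cf df] [cg dg].
  by split=> // x Ux; apply: continuousD; [exact: cf | exact: cg].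
split=> [x Ux|i]; first by apply: continuousD; [exact: cf | exact: cg].
have [[dfi Cf] [dgi Cg]] := (df i, dg i).
split=> [x Ux|]; first by apply: derivableD; [exact: dfi | exact: dgi].
apply: Ck_ext (IH _ _ Cf Cg) => // x Ux.
by rewrite deriveD; [|exact: dfi|exact: dgi].
Qed.

Lemma CkM k U f g : open U -> Ck k U f -> Ck k U g -> Ck k U (f * g).
Proof.
move=> oU; elim: k f g => [|k IH] f g Ckf Ckg.
all: have [[cf df] [cg dg]] := (Ckf, Ckg).
  by split=> // x Ux; apply: continuousM; [exact: cf | exact: cg].
split=> [x Ux|i]; first by apply: continuousM; [exact: cf | exact: cg].
have [[dfi Cf] [dgi Cg]] := (df i, dg i).
split=> [x Ux|]; first by apply: derivableM; [exact: dfi | exact: dgi].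
apply: Ck_ext (CkD oU (IH _ _ (CkS Ckf) Cg) (IH _ _ (CkS Ckg) Cf)) => // x Ux.
by rewrite deriveM; [|exact: dfi|exact: dgi].
Qed.

End EuclideanSmoothness.

(* A homeomorphism from an open subset of [M] onto an open subset of R^n.
   Values of [cmap] off [cdom], and of [cinv] off the image, are junk. *)
Record chart (R : realType) (n : nat) (M : topologicalType) := Chart {
  cdom : set M;
  cmap : M -> 'rV[R]_n;
  cinv : 'rV[R]_n -> M;
  cdom_open : open cdom;
  cimg_open : open (cmap @` cdom);
  cmapK : forall x, cdom x -> cinv (cmap x) = x;
  cmap_continuous : forall x, cdom x -> {for x, continuous cmap};
  cinv_continuous : forall y, (cmap @` cdom) y -> {for y, continuous cinv}
}.

Definition smooth_transition (R : realType) (n : nat) (M : topologicalType)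
    (c d : chart R n M) :=
  forall i : 'I_n, smooth_on (cmap c @` (cdom c `&` cdom d))
                             (fun y => cmap d (cinv c y) 0 i).

(* The atlas need not be maximal: it determines the smooth structure. *)
Record manifold (R : realType) (n : nat) := Manifold {
  msort :> topologicalType;
  manifold_hausdorff : hausdorff_space msort;
  manifold_second_countable : @second_countable msort;
  atlas : set (chart R n msort);
  atlas_cover : forall x, exists2 c, atlas c & cdom c x;
  atlas_compatible : forall c d, atlas c -> atlas d -> smooth_transition c d
}.

Section SmoothFunctions.
Variables (R : realType) (n : nat) (M : manifold R n).
Implicit Types f g : M -> R.

Definition smooth f :=
  forall c, atlas c -> smooth_on (cmap c @` cdom c) (f \o cinv c).

Lemma smooth_cst (a : R) : smooth (fun=> a).
Proof. by move=> c _ k; exact: Ck_cst. Qed.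

Lemma smoothD f g : smooth f -> smooth g -> smooth (f + g).
Proof.
by move=> sf sg c Ac k; apply: CkD; [exact: cimg_open|exact: sf|exact: sg].
Qed.

Lemma smoothM f g : smooth f -> smooth g -> smooth (f * g).
Proof.
by move=> sf sg c Ac k; apply: CkM; [exact: cimg_open|exact: sf|exact: sg].
Qed.

Lemma smoothZ (a : R) f : smooth f -> smooth (a *: f).
Proof. by move=> sf; exact: (smoothM (smooth_cst a) sf). Qed.

Lemma smoothN f : smooth f -> smooth (- f).
Proof. by move=> sf; rewrite -scaleN1r; exact: smoothZ. Qed.

Definition smoothb : {pred M -> R} := fun f => `[< smooth f >].

Lemma smoothbP f : reflect (smooth f) (f \in smoothb).
Proof. exact: asboolP. Qed.

Lemma smoothb_subring : subring_closed smoothb.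
Proof.
split=> [|f g /smoothbP sf /smoothbP sg|f g /smoothbP sf /smoothbP sg].
- by apply/smoothbP; exact: smooth_cst.
- by apply/smoothbP; apply: smoothD => //; exact: smoothN.
- by apply/smoothbP; exact: smoothM.
Qed.

Lemma smoothb_scaler : GRing.scaler_closed smoothb.
Proof. by move=> a f /smoothbP sf; apply/smoothbP; exact: smoothZ. Qed.

HB.instance Definition _ :=
  GRing.isSubringClosed.Build (M -> R) smoothb smoothb_subring.
HB.instance Definition _ :=
  GRing.isScaleClosed.Build R (M -> R) smoothb smoothb_scaler.

(* C^oo(M), as a commutative ring and an R-module. *)
Record Cinf := MkCinf { cfun :> M -> R; cfunP : cfun \in smoothb }.
HB.instance Definition _ := [isSub for cfun].
HB.instance Definition _ := [Choice of Cinf by <:].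
HB.instance Definition _ := 
  GRing.SubChoice_isSubComPzRing.Build _ _ Cinf (GRing.subringClosedP _).
HB.instance Definition _ := [SubZmodule_isSubLmodule of Cinf by <:].

End SmoothFunctions.

(* T_pM, as the space of derivations of C^oo(M) at p. *)
Section TangentSpace.
Variables (R : realType) (n : nat) (M : manifold R n) (p : M).

Definition point_derivation (v : Cinf M -> R) :=
  scalar v /\ forall f g : Cinf M, v (f * g) = f p * v g + g p * v f.

Definition point_derivationb : {pred Cinf M -> R} :=
  fun v => `[< point_derivation v >].

Lemma point_derivationbP v :
  reflect (point_derivation v) (v \in point_derivationb).
Proof. exact: asboolP. Qed.

Lemma point_derivationb_submod : GRing.submod_closed point_derivationb.
Proof.
split=> [|a u v /point_derivationbP[lu du] /point_derivationbP[lv dv]].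
  apply/point_derivationbP; split=> [a f g|f g].
    have H : 0 = a * 0 + 0 :> R by rewrite !mulr0 addr0.
    exact: H.
  have H : 0 = f p * 0 + g p * 0 :> R by rewrite !mulr0 addr0.
  exact: H.
have E f : (a *: u + v) f = a * u f + v f by [].
apply/point_derivationbP; split=> [b f g|f g]; rewrite !E.
  by rewrite lu lv; ring.
by rewrite du dv; ring.
Qed.

HB.instance Definition _ :=
  GRing.isSubmodClosed.Build R (Cinf M -> R) point_derivationb
    point_derivationb_submod.

Record tangent := MkTangent {
  tangent_fun :> Cinf M -> R;
  tangentP : tangent_fun \in point_derivationb
}.
HB.instance Definition _ := [isSub for tangent_fun].
HB.instance Definition _ := [Choice of tangent by <:].
HB.instance Definition _ := [SubChoice_isSubLmodule of tangent by <:].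

End TangentSpace.
Arguments tangent {R n} M p.

Section VectorFields.
Variables (R : realType) (n : nat) (M : manifold R n).

Lemma tangent_ext (p : M) (u v : tangent M p) :
  (forall f : Cinf M, u f = v f) -> u = v.
Proof. by move=> uv; apply: val_inj; rewrite funeqE => f; exact: uv. Qed.

Lemma tangent_lin (p : M) (v : tangent M p) (a : R) (f g : Cinf M) :
  v (a *: f + g) = a * v f + v g.
Proof. by have /point_derivationbP[lv _] := tangentP v; rewrite lv. Qed.

Lemma tangentM (p : M) (v : tangent M p) (f g : Cinf M) :
  v (f * g) = f p * v g + g p * v f.
Proof. by have /point_derivationbP[_ ->] := tangentP v. Qed.

(* Smooth sections of TM: smoothness of X is tested on functions. *)
Record vfield := MkVfield {
  vfield_fun :> forall p : M, tangent M p;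
  vfieldP : forall f : Cinf M, smooth (fun p => vfield_fun p f)
}.

HB.instance Definition _ := gen_eqMixin vfield.
HB.instance Definition _ := gen_choiceMixin vfield.

Implicit Types (X Y Z : vfield) (f g h : Cinf M).

Lemma vfield_ext X Y : (forall p, X p = Y p) -> X = Y.
Proof.
case: X Y => [X sX] [Y sY] /= XY.
have {}XY : X = Y by apply: functional_extensionality_dep.
by case: _ / XY sY => sY; congr MkVfield; exact: Prop_irrelevance.
Qed.

Definition vder X f : Cinf M := MkCinf (introT (smoothbP _) (vfieldP X f)).

Fact vzero_smooth f : smooth (fun p => (0 : tangent M p) f).
Proof. exact: smooth_cst. Qed.
Definition vzero := MkVfield vzero_smooth.

Fact vadd_smooth X Y f : smooth (fun p => (X p + Y p) f).
Proof. exact: smoothD (vfieldP X f) (vfieldP Y f). Qed.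
Definition vadd X Y := MkVfield (vadd_smooth X Y).

Fact vopp_smooth X f : smooth (fun p => (- X p) f).
Proof. exact: smoothN (vfieldP X f). Qed.
Definition vopp X := MkVfield (vopp_smooth X).

Fact vscale_smooth h X f : smooth (fun p => (h p *: X p) f).
Proof. exact: smoothM (elimT (smoothbP _) (cfunP h)) (vfieldP X f). Qed.
Definition vscale h X := MkVfield (vscale_smooth h X).

Fact vaddA : associative vadd.
Proof. by move=> X Y Z; apply: vfield_ext => p /=; exact: addrA. Qed.
Fact vaddC : commutative vadd.
Proof. by move=> X Y; apply: vfield_ext => p /=; exact: addrC. Qed.
Fact vadd0 : left_id vzero vadd.
Proof. by move=> X; apply: vfield_ext => p /=; exact: add0r. Qed.
Fact vaddN : left_inverse vzero vopp vadd.
Proof. by move=> X; apply: vfield_ext => p /=; exact: addNr. Qed.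
HB.instance Definition _ := GRing.isZmodule.Build vfield vaddA vaddC vadd0 vaddN.

Fact vscaleA f g X : vscale f (vscale g X) = vscale (f * g) X.
Proof. by apply: vfield_ext => p /=; exact: scalerA. Qed.
Fact vscale1 : left_id 1 vscale.
Proof. by move=> X; apply: vfield_ext => p /=; exact: scale1r. Qed.
Fact vscaleDr : right_distributive vscale +%R.
Proof. by move=> f X Y; apply: vfield_ext => p /=; exact: scalerDr. Qed.
Fact vscaleDl X : {morph vscale^~ X : f g / f + g}.
Proof. by move=> f g; apply: vfield_ext => p /=; exact: scalerDl. Qed.
HB.instance Definition _ := GRing.Zmodule_isLmodule.Build (Cinf M) vfield
  vscaleA vscale1 vscaleDr vscaleDl.

Definition bracket_fun X Y (p : M) f : R := X p (vder Y f) - Y p (vder X f).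

Fact bracket_subproof X Y p : bracket_fun X Y p \in @point_derivationb _ _ M p.
Proof.
have vderL Z a f g : vder Z (a *: f + g) = a *: vder Z f + vder Z g.
  by apply: val_inj; rewrite funeqE => q; exact: tangent_lin.
have vderM Z f g : vder Z (f * g) = f * vder Z g + g * vder Z f.
  by apply: val_inj; rewrite funeqE => q; exact: tangentM.
have tangentD (v : tangent M p) f g : v (f + g) = v f + v g.
  by rewrite -[f]scale1r tangent_lin mul1r scale1r.
apply/point_derivationbP; split=> [a f g|f g]; rewrite /bracket_fun.
  by rewrite !vderL !tangent_lin /=; ring.
by rewrite !vderM !tangentD !tangentM /=; ring.
Qed.

Fact bracket_smooth X Y f :
  smooth (fun p => MkTangent (bracket_subproof X Y p) f).
Proof.
exact: smoothD (vfieldP X (vder Y f)) (smoothN (vfieldP Y (vder X f))).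
Qed.

Definition bracket X Y : vfield := MkVfield (bracket_smooth X Y).

End VectorFields.
Arguments vfield {R n} M.

Section RiemannianGeometry.
Variables (R : realType) (n : nat) (M : manifold R n).

Record riemannian_metric := RiemannianMetric {
  metric :> forall p : M, tangent M p -> tangent M p -> R;
  metric_linear : forall p v, scalar (fun u : tangent M p => metric u v);
  metric_sym : forall p (u v : tangent M p), metric u v = metric v u;
  metric_gt0 : forall p (v : tangent M p), v != 0 -> 0 < metric v v;
  metric_smooth : forall X Y : vfield M, smooth (fun p => metric (X p) (Y p))
}.

Definition inner (g : riemannian_metric) (X Y : vfield M) : Cinf M :=
  MkCinf (introT (smoothbP _) (metric_smooth g X Y)).

(* [nabla X Y] is the covariant derivative of Y along X. *)
Record connection := Connection {
  nabla :> vfield M -> vfield M -> vfield M;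
  nabla_linearl : forall Y, linear (nabla^~ Y);
  nabla_additiver : forall X Y Z, nabla X (Y + Z) = nabla X Y + nabla X Z;
  nabla_leibniz : forall X (f : Cinf M) Y,
    nabla X (f *: Y) = vder X f *: Y + f *: nabla X Y
}.

Definition torsion_free (nabla : connection) :=
  forall X Y : vfield M, nabla X Y - nabla Y X = bracket X Y.

Definition metric_compatible (g : riemannian_metric) (nabla : connection) :=
  forall X Y Z : vfield M,
    vder X (inner g Y Z) = inner g (nabla X Y) Z + inner g Y (nabla X Z).

Definition levi_civita (g : riemannian_metric) (nabla : connection) :=
  torsion_free nabla /\ metric_compatible g nabla.

(* R(X, Y) Z on vector fields, with R(X, Y) = [nabla_X, nabla_Y] - nabla_[X, Y]. *)
Definition curvature (nabla : connection) (X Y Z : vfield M) : vfield M :=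
  nabla X (nabla Y Z) - nabla Y (nabla X Z) - nabla (bracket X Y) Z.

(* A smooth vector field with value [v] at [p]. One always exists (multiply a
   constant-coefficient field of a chart by a bump function), so the default
   value 0 is never used. *)
Definition extend (p : M) (v : tangent M p) : vfield M :=
  xget 0 [set X : vfield M | X p = v].

(* R(u, v) w at p. The field [curvature nabla X Y Z] is C^oo(M)-linear in X, Y
   and Z, so its value at p depends only on X p, Y p and Z p: the choice of
   extensions is immaterial. *)
Definition riemann (nabla : connection) (p : M) (u v w : tangent M p) :
    tangent M p :=
  curvature nabla (extend u) (extend v) (extend w) p.

Definition solves_SVP (g : riemannian_metric) (nabla : connection) (p : M)
    (W X Y Z : tangent M p) (sigma : R) :=
  [/\ riemann nabla Y Z X = sigma *: W,
      riemann nabla Z Y W = sigma *: X,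
      riemann nabla W X Z = sigma *: Y
    & riemann nabla X W Y = sigma *: Z] /\
  [/\ g p W W = 1, g p X X = 1, g p Y Y = 1 & g p Z Z = 1].

End RiemannianGeometry.

(* Main.v *)
Require Import Defs.
From mathcomp Require Import all_boot all_order all_algebra.
From mathcomp Require Import all_classical all_reals all_analysis.
Import GRing.Theory.
Local Open Scope ring_scope.

(** Swapping both pairs, W with X and Y with Z, or exchanging the pair (W, X)
    with (Y, Z), only permutes the four equations of the singular value problem.
    Swapping a single pair gives the same four equations, up to order, with the
    two arguments of the curvature operator reversed in each. Since
    R(u, v) = - R(v, u) ([riemann_antisym]), this amounts to replacing sigma by
    - sigma. The antisymmetry of R comes from that of the Lie bracket and from
    the additivity of a connection in its direction argument. *)

Lemma bracket_antisym (R : realType) (n : nat) (M : manifold R n)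
    (X Y : vfield M) : bracket X Y = - bracket Y X.
Proof.
apply: vfield_ext => q; apply: tangent_ext => f.
by symmetry; exact: opprB.
Qed.

Lemma nablaNl (R : realType) (n : nat) (M : manifold R n)
    (nabla : connection M) (X Y : vfield M) : nabla (- X) Y = - nabla X Y.
Proof.
have nabla0 : nabla 0 Y = 0.
  by have := nabla_linearl nabla Y (-1) 0 0; rewrite scaler0 addr0 scaleN1r addNr.
by have := nabla_linearl nabla Y (-1) X 0; rewrite nabla0 !addr0 !scaleN1r.
Qed.

Lemma curvature_antisym (R : realType) (n : nat) (M : manifold R n)
    (nabla : connection M) (X Y Z : vfield M) :
  curvature nabla X Y Z = - curvature nabla Y X Z.
Proof.
by rewrite /curvature (bracket_antisym _ _ _ X) nablaNl opprK !opprB addrC.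
Qed.

(** Both sides evaluate the curvature on the same extensions of u, v and w, so
    the identity between vector fields specializes to p. *)
Lemma riemann_antisym (R : realType) (n : nat) (M : manifold R n)
    (nabla : connection M) (p : M) (u v w : tangent M p) :
  riemann nabla u v w = - riemann nabla v u w.
Proof. by rewrite /riemann curvature_antisym. Qed.

Theorem proposition3 (R : realType) (n : nat) (M : manifold R n)
    (g : riemannian_metric M) (nabla : connection M)
    (nablaP : levi_civita g nabla)
    (p : M) (W X Y Z : tangent M p) (sigma : R) :
  solves_SVP g nabla W X Y Z sigma ->
  [/\ solves_SVP g nabla X W Y Z (- sigma),
      solves_SVP g nabla W X Z Y (- sigma),
      solves_SVP g nabla X W Z Y sigma
    & solves_SVP g nabla Y Z W X sigma].
Proof.
move=> [[eW eX eY eZ] [nW nX nY nZ]].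
have flip u v w x : riemann nabla u v w = sigma *: x ->
    riemann nabla v u w = - sigma *: x.
  by move=> e; rewrite riemann_antisym e scaleNr.
by split; split; split=> //; exact: flip.
Qed.
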